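(* Let $k\ge3$. For $n\ge k+1$, the gap $G_n$ occurring between the two successive kernel words $R_n$ and $R_{n+1}$ is given by $$G_n=\begin{cases}G_{n-k}\Big(\prod_{i=k-1}^{2}(R_{n-i}G_{n-i})\Big)R_{n-1}[1,r_{n-2}+1]\;s_k^{n-2}(2)\,\ast & \text{if } n-1\equiv 1\pmod k,\\ G_{n-k}\Big(\prod_{i=k-1}^{2}(R_{n-i}G_{n-i})\Big)R_{n-1}[1,r_{n-2}]\;s_k^{n-2}(2)\,\ast & \text{otherwise,}\end{cases}$$ where $\ast$ is a suffix of $s_k^{n-2}(0)$ and is defined by $$\ast=\begin{cases}R_{n+1}[1,r_n+1]^{-1} & \text{if } n\equiv0\pmod k,\\ R_{n+1}[1,r_n]^{-1} & \text{otherwise.}\end{cases}$$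
   Context: Let $\mathcal{A}_k=\{0,1,\dots,k-1\}$ and let $s_k$ be the morphism of $\mathcal{A}_k^*$ with $s_k(m)=0(m+1)$ (a two-letter word) for $0\le m\le k-2$ and $s_k(k-1)=00$. The generalized period-doubling sequence is $\mathbf{P}_k=\lim_n s_k^n(0)$. Mirror substitution: $\tilde s_k$ is the morphism with $\tilde s_k(m)=\mathbf{E}_k(m)0$, where $\mathbf{E}_k(m)=m+1$ for $0\le m\le k-2$ and $\mathbf{E}_k(k-1)=0$. Words: $\varepsilon$ is the empty word; $u[i,j]$ is the factor of $u$ from its $i$-th to its $j$-th letter (letters indexed from 1). $v^{-1}$ is the inverse of the word $v$, with $vv^{-1}=v^{-1}v=\varepsilon$; thus $uv^{-1}$ is $u$ with its suffix $v$ deleted and $0^{-1}u$ is $u$ with its first letter $0$ deleted. The product $\prod_{i=k-1}^{2}$ is a concatenation in decreasing order of $i$, from $i=k-1$ down to $i=2$. Kernel numbers: $r_0=0$, $r_1=\dots=r_k=1$, and $r_i=r_{i-1}+r_{i-2}+\cdots+r_{i-(k-1)}+2r_{i-k}-(k-2)$ for $i>k$. Kernel words: $R_0=\varepsilon$, $R_i$ is the one-letter word $(i-1)$ for $1\le i\le k$, $R_{k+1}=000$, $R_{k+2}=10101$, and for $i>k+2$, $R_i=0^{-1}s_k(R_{i-1})$ if $i$ is even and $R_i=s_k(R_{i-1})0$ otherwise. Palindromic prefixes: $p_0=\varepsilon$, $p_{n+1}=p_n\vartheta_np_n$ with $\vartheta_n=n \bmod k$ viewed as a letter. Gap words ($G_n$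 denotes the gap between the kernel words $R_n$ and $R_{n+1}$ in $\mathbf{P}_k$): $G_n=p_{n-1}$ for $1\le n\le k-1$; $G_k=s_k(G_{k-1})$; $G_{k+1}=\tilde s_k(G_k)$; and $G_n=s_k(G_{n-1})0$ for all $n\ge k+2$.
   Formalization: For i>k+2, R_i=s_k(R_{i-1})0 iff i≡1 (mod k), not iff i is odd; for n≥k, G_n is s_k(G_{n-1}), s̃_k(G_{n-1}) or s_k(G_{n-1})0 as n≡0, n≡1 or otherwise mod k; the word cancelled by ∗ is a suffix of s_k^{n-2}(2), not s_k^{n-2}(0). As printed the formula fails. *)

(* Defs.v *)
(* MathComp *)
From mathcomp Require Import all_boot zify.

Set Implicit Arguments.
Unset Strict Implicit.
Unset Printing Implicit Defensive.

(* Letters are natural numbers; the alphabet {0, ..., k-1} is preserved by     *)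
(* every construction below, so the values on letters m >= k are irrelevant.   *)
Definition word := seq nat.

Definition morph (f : nat -> word) (u : word) : word := flatten (map f u).

Definition pd_letter (k m : nat) : word :=
  if m <= k - 2 then [:: 0; m.+1] else [:: 0; 0].

Definition pd (k : nat) : word -> word := morph (pd_letter k).

Definition Eshift (k m : nat) : nat := if m <= k - 2 then m.+1 else 0.

Definition pd_mirror (k : nat) : word -> word :=
  morph (fun m => [:: Eshift k m; 0]).

(* The words s_k^n(0) have length 2^n and are prefixes of one another, so the  *)
(* i-th letter (from 0) of their limit can be read off s_k^i.+1(0).            *)
Definition pd_limit (k i : nat) : nat := nth 0 (iter i.+1 (pd k) [:: 0]) i.

(* u[i,j], letters indexed from 1, both ends included. *)
Definition factor (u : word) (i j : nat) : word := drop i.-1 (take j u).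

(* v^-1 u and u v^-1; meaningful when v is a prefix, resp. a suffix, of u. *)
Definition ldel (v u : word) : word := drop (size v) u.
Definition rdel (u v : word) : word := take (size u - size v) u.

(* [:: r_i; r_(i-1); ...; r_0]; see kernel_numberE for the recurrence. The     *)
(* subtraction never truncates: the r_j involved are at least 1.               *)
Fixpoint kernel_numbers (k i : nat) : seq nat :=
  if i is i'.+1 then
    let t := kernel_numbers k i' in
    (if i <= k then 1
     else \sum_(1 <= j < k) nth 0 t j.-1 + 2 * nth 0 t k.-1 - (k - 2)) :: t
  else [:: 0].

Definition kernel_number (k i : nat) : nat := head 0 (kernel_numbers k i).

(* Beyond R_(k+2), s_k(R_(i-1)) is extended by a letter 0 exactly when         *)
(* i = 1 mod k. With k = 2 this is the distinction between odd and even i; for *)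
(* k >= 3 it is the only rule for which |R_i| = r_i (size_kernel_word), since  *)
(* r_i - 2 r_(i-1) is 1 if i = 1 mod k and -1 otherwise.                       *)
Fixpoint kernel_word (k i : nat) : word :=
  if i is i'.+1 then
    if i <= k then [:: i']
    else if i == k.+1 then [:: 0; 0; 0]
    else if i == k.+2 then [:: 1; 0; 1; 0; 1]
    else if i == 1 %[mod k] then pd k (kernel_word k i') ++ [:: 0]
    else ldel [:: 0] (pd k (kernel_word k i'))
  else [::].

Fixpoint pal_prefix (k n : nat) : word :=
  if n is n'.+1 then pal_prefix k n' ++ [:: n' %% k] ++ pal_prefix k n'
  else [::].

(* From n = k on, the rule depends on n mod k: the forms taken at n = k and    *)
(* n = k + 1 recur at every n = 0 and n = 1 mod k. This is what makes G_n the  *)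
(* gap between R_n and R_(n+1), see kernel_gap_factorization. G_0 is junk.     *)
Fixpoint gap (k n : nat) : word :=
  if n is n'.+1 then
    if n < k then pal_prefix k n'
    else if n == 0 %[mod k] then pd k (gap k n')
    else if n == 1 %[mod k] then pd_mirror k (gap k n')
    else pd k (gap k n') ++ [:: 0]
  else [::].

(* f a f (a-1) ... f b, decreasing; empty if a < b. *)
Definition catdown (a b : nat) (f : nat -> word) : word :=
  flatten [seq f i | i <- rev (iota b (a.+1 - b))].

(* The word v cancelled on the right of s_k^(n-2)(2). It is a suffix of that    *)
(* word, hence not of s_k^(n-2)(0): the two differ in their last letter.       *)
Definition starred (k n : nat) : word :=
  if n == 0 %[mod k] then factor (kernel_word k n.+1) 1 (kernel_number k n).+1
  else factor (kernel_word k n.+1) 1 (kernel_number k n).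

(* R_1 G_1 R_2 G_2 ... R_n G_n *)
Definition kernel_gap_product (k n : nat) : word :=
  flatten [seq kernel_word k i ++ gap k i | i <- iota 1 n].

Lemma kernel_numberE (k i : nat) : 0 < k < i ->
  kernel_number k i = \sum_(1 <= j < k) kernel_number k (i - j)
                      + 2 * kernel_number k (i - k) - (k - 2).
Proof.
have nthE m j : j <= m -> nth 0 (kernel_numbers k m) j = kernel_number k (m - j).
  by elim: m j => [|m IH] [|j] //; rewrite ltnS => /IH; rewrite subSS.
case: i => [|i]; first by rewrite ltn0 andbF.
move=> /andP[k_gt0 lt_ki]; rewrite {1}/kernel_number /= leqNgt lt_ki /=.
rewrite [in LHS]big_nat [in RHS]big_nat.
congr (_ + 2 * _ - _).
  by apply: eq_bigr => j ?; rewrite nthE; [congr kernel_number|]; lia.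
by rewrite nthE; [congr kernel_number|]; lia.
Qed.

Lemma kernel_number_small (k i : nat) : 0 < i <= k -> kernel_number k i = 1.
Proof. by case: i => // i /andP[_ le]; rewrite /kernel_number /= le. Qed.

Lemma kernel_numberS (k i : nat) : 2 < k ->
  0 < kernel_number k i.+1 /\
  kernel_number k i.+1 + (i.+1 %% k != 1) =
    2 * kernel_number k i + (i.+1 %% k == 1).
Proof.
move=> k_gt2; elim/ltn_ind: i => i IH.
have pos j : 0 < j <= i -> 0 < kernel_number k j.
  by case: j => // j /andP[_ /IH[]].
case: (ltngtP i k) => [lt_ik|lt_ki|->].
- rewrite kernel_number_small; last by lia.
  split=> //; case: i lt_ik {IH pos} => [|i] lt_ik.
    by rewrite modn_small ?/kernel_number //=; lia.
  rewrite kernel_number_small; last by lia.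
  have [->|neq] := eqVneq i.+2 k; first by rewrite modnn.
  by rewrite modn_small; lia.
- have E1 := @kernel_numberE k i.+1 _; have E0 := @kernel_numberE k i _.
  have [_ IHd] := IH (i - k) ltac:(lia).
  have -> : i.+1 %% k = (i - k).+1 %% k.
    by rewrite -[in LHS](subnK (ltnW lt_ki)) -addSn modnDr.
  have S1 : \sum_(1 <= j < k) kernel_number k (i.+1 - j)
     + kernel_number k (i - k).+1
     = kernel_number k i + \sum_(1 <= j < k) kernel_number k (i - j).
    case: k k_gt2 lt_ki {IH E1 E0 IHd pos} => // k k_gt2 lt_ki.
    rewrite [X in _ = _ + X]big_nat_recr /=; last by lia.
    rewrite big_ltn; last by lia.
    rewrite big_add1 /= subSS subn0 -addnA; congr (_ + (_ + _)).
    by congr kernel_number; lia.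
  have ge1 m : i <= m.+1 -> m <= i ->
      k - 2 <= \sum_(1 <= j < k) kernel_number k (m.+1 - j).
    move=> le1 le2; apply: (@leq_trans (\sum_(1 <= j < k) 1)).
      by rewrite sum_nat_const_nat; lia.
    rewrite [leqLHS]big_nat [leqRHS]big_nat; apply: leq_sum => j ?.
    by apply: pos; lia.
  have g1 := ge1 i ltac:(lia) ltac:(lia).
  have g0 := ge1 i.-1 ltac:(lia) ltac:(lia).
  rewrite prednK in g0; last by lia.
  have e1 := E1 ltac:(lia); have e0 := E0 ltac:(lia).
  have p1 := pos i ltac:(lia).
  rewrite subSn in e1; last by lia.
  split; lia.
- have kk : k.+1 %% k = 1 by rewrite -addn1 modnDl modn_small; lia.
  rewrite kernel_numberE; last by lia.
  rewrite kk eqxx (@kernel_number_small k k); last by lia.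
  rewrite (@kernel_number_small k (k.+1 - k)); last by lia.
  rewrite big_nat (eq_bigr (fun=> 1)); last first.
    by move=> j ?; rewrite kernel_number_small; lia.
  rewrite -big_nat.
  by rewrite sum_nat_const_nat; lia.
Qed.

Lemma size_morph2 (f : nat -> word) (u : word) :
  (forall m, size (f m) = 2) -> size (morph f u) = 2 * size u.
Proof.
by move=> f2; elim: u => //= m u IH; rewrite /morph /= size_cat f2 IH; lia.
Qed.

Lemma size_pd (k : nat) (u : word) : size (pd k u) = 2 * size u.
Proof. by apply: size_morph2 => m; rewrite /pd_letter; case: ifP. Qed.

Lemma size_kernel_word (k i : nat) : 2 < k ->
  size (kernel_word k i) = kernel_number k i.
Proof.
move=> k_gt2; elim: i => // i IH; have [_ E] := kernel_numberS i k_gt2.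
have k2 : k.+2 %% k = 2 by rewrite -addn2 modnDl modn_small.
have k1 : k.+1 %% k = 1 by rewrite -addn1 modnDl modn_small //; lia.
have rk : kernel_number k k.+1 = 3.
  have [_] := kernel_numberS k k_gt2.
  by rewrite k1 (@kernel_number_small k k); lia.
rewrite /=; case: ifP => [le|nle]; first by rewrite kernel_number_small.
case: eqP => [->|ne1]; first by rewrite rk.
case: eqP => [ek|ne2].
  have ei : i = k.+1 by lia.
  by move: E; rewrite ek k2 ei rk /=; lia.
rewrite (@modn_small 1); last by lia.
by case: ifP E => _ E; rewrite ?size_cat ?size_drop size_pd IH /=; lia.
Qed.

Lemma pd_cat (k : nat) (u v : word) : pd k (u ++ v) = pd k u ++ pd k v.
Proof. by rewrite /pd /morph map_cat flatten_cat. Qed.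

Lemma pd_mirrorE (k : nat) (u : word) : 0 :: pd_mirror k u = pd k u ++ [:: 0].
Proof.
elim: u => //= m u IH; rewrite /pd_mirror /pd /morph /= in IH *.
by rewrite IH /pd_letter /Eshift; case: ifP.
Qed.

Lemma pd_pal_prefix (k n : nat) : n < k ->
  pd k (pal_prefix k n) ++ [:: 0] = pal_prefix k n.+1.
Proof.
elim: n => [|n IH] lt_nk; first by rewrite /= mod0n.
have E : pal_prefix k n.+2
    = pal_prefix k n.+1 ++ [:: n.+1] ++ pal_prefix k n.+1.
  by rewrite [LHS]/= (modn_small lt_nk).
have pdn : pd k [:: n] = [:: 0; n.+1].
  by rewrite /pd /morph /= /pd_letter (_ : n <= k - 2) //; lia.
rewrite E -[in RHS](IH (ltnW lt_nk)) [pal_prefix k n.+1]/= modn_small 1?ltnW //.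
by rewrite pd_cat -cat1s pd_cat pdn -!catA.
Qed.

Lemma kernel_gap_productS (k n : nat) :
  kernel_gap_product k n.+1 =
    kernel_gap_product k n ++ kernel_word k n.+1 ++ gap k n.+1.
Proof.
rewrite /kernel_gap_product -(addn1 n) iotaD map_cat flatten_cat.
by rewrite add1n addn1 [flatten [seq _ | _ <- iota _ 1]]/= cats0.
Qed.

Lemma pd_kernel_word (k n : nat) : 2 < k ->
  (if n.+1 == 0 %[mod k] then [::] else [:: 0]) ++ kernel_word k n.+2
  = pd k (kernel_word k n.+1) ++ (if n.+2 == 1 %[mod k] then [:: 0] else [::]).
Proof.
move=> k_gt2.
have RS i : kernel_word k i.+1 = if i < k then [:: i]
    else if i.+1 == k.+1 then [:: 0; 0; 0]
    else if i.+1 == k.+2 then [:: 1; 0; 1; 0; 1]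
    else if i.+1 == 1 %[mod k] then pd k (kernel_word k i) ++ [:: 0]
    else ldel [:: 0] (pd k (kernel_word k i)) by [].
have pd0 u : 0 < size u -> 0 :: ldel [:: 0] (pd k u) = pd k u.
  case: u => // a u _; rewrite /pd /morph /= /pd_letter.
  by case: ifP.
have R0 : 0 < size (kernel_word k n.+1).
  by rewrite size_kernel_word //; case: (kernel_numberS n k_gt2).
have mS : n.+2 %% k = if n.+1 %% k == k.-1 then 0 else (n.+1 %% k).+1.
  have lt : n.+1 %% k < k by rewrite ltn_pmod //; lia.
  rewrite -(addn1 n.+1) -modnDml addn1; case: eqP => [->|ne].
    by rewrite prednK ?modnn //; lia.
  by rewrite modn_small //; lia.
rewrite mod0n (@modn_small 1); last by lia.
case: (ltngtP n.+1 k) => [lt|gt|e].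
- rewrite !RS lt (ltnW lt) modn_small //.
  rewrite (_ : n.+2 %% k == 1 = false) /pd /morph /= /pd_letter; last first.
    by rewrite mS modn_small //; case: ifP; lia.
  by rewrite (_ : n <= k - 2) //; lia.
- rewrite RS (ltnNge n.+1 k) (ltnW gt) eqSS (gtn_eqF gt) [negb _]/=.
  case: (n.+2 =P k.+2) => [e|ne].
    have -> : n.+1 = k.+1 by lia.
    have k1 : k.+1 %% k = 1 by rewrite -addn1 modnDl modn_small //; lia.
    have k2 : k.+2 %% k = 2 by rewrite -addn2 modnDl modn_small.
    by rewrite k1 k2 RS ltnn eqxx.
  rewrite (@modn_small 1); last by lia.
  have -> : (n.+2 %% k == 1) = (n.+1 %% k == 0) by rewrite mS; case: ifP; lia.
  by case: ifP => _ //; rewrite cats0 -[RHS]pd0.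
- have k1 : k.+1 %% k = 1 by rewrite -addn1 modnDl modn_small //; lia.
  subst k; rewrite [kernel_word _ n.+2]RS ltnn !eqxx k1 modnn RS ltnSn.
  by rewrite /pd /morph /= /pd_letter; case: ifP => //; lia.
Qed.

Lemma pd_gap (k n : nat) : 2 < k -> 0 < n ->
  (if n.+1 == 1 %[mod k] then [:: 0] else [::]) ++ gap k n.+1
  = pd k (gap k n) ++ (if n.+1 == 0 %[mod k] then [::] else [:: 0]).
Proof.
move=> k_gt2 n_gt0.
have GS i : gap k i.+1 = if i.+1 < k then pal_prefix k i
    else if i.+1 == 0 %[mod k] then pd k (gap k i)
    else if i.+1 == 1 %[mod k] then pd_mirror k (gap k i)
    else pd k (gap k i) ++ [:: 0] by [].
rewrite GS mod0n (@modn_small 1); last by lia.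
case: (ltnP n.+1 k) => [lt|_].
  rewrite modn_small // eqSS (gtn_eqF n_gt0) /=.
  case: n n_gt0 lt => // n _ lt.
  by rewrite GS (ltnW lt) pd_pal_prefix //; lia.
case: (_ =P 1) => [->|_]; first by rewrite -pd_mirrorE.
by case: (_ =P 0) => _; rewrite ?cats0.
Qed.

Lemma pd_kernel_gap_product (k n : nat) : 2 < k ->
  kernel_gap_product k n.+1 = pd k (kernel_gap_product k n)
    ++ (if n.+1 == 0 %[mod k] then [::] else [:: 0]).
Proof.
move=> k_gt2; elim: n => [|n IH].
  rewrite kernel_gap_productS /= (ltnW (ltnW k_gt2)) (ltnW k_gt2).
  by rewrite mod0n modn_small // ltnW.
rewrite kernel_gap_productS [in RHS]kernel_gap_productS IH !pd_cat -!catA.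
by congr (_ ++ _); rewrite catA pd_kernel_word // -catA pd_gap.
Qed.

Lemma prefix_pd_limit (k m : nat) (u : word) :
  prefix u (iter m (pd k) [:: 0]) -> u = mkseq (pd_limit k) (size u).
Proof.
have szP j : size (iter j (pd k) [:: 0]) = 2 ^ j.
  by elim: j => //= j IH; rewrite size_pd IH expnS.
have pref j d : prefix (iter j (pd k) [:: 0]) (iter (j + d) (pd k) [:: 0]).
  elim: j => [|j /prefixP[v IH]] /=.
    elim: d => //= d; case: (iter _ _ _) => // a u' /=.
    by rewrite /pd /morph /= /pd_letter; case: ifP; case: eqP.
  by rewrite IH pd_cat prefix_prefix.
have nthP i j : i < 2 ^ j -> nth 0 (iter j (pd k) [:: 0]) i = pd_limit k i.
  rewrite /pd_limit => lt.
  have lt' : i < 2 ^ i.+1 by apply: ltn_trans (ltn_expl _ _).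
  case: (leqP j i.+1) => le.
    have /prefixP[v] := pref j (i.+1 - j); rewrite subnKC // => ->.
    by rewrite nth_cat szP lt.
  have /prefixP[v] := pref i.+1 (j - i.+1); rewrite subnKC 1?ltnW // => ->.
  by rewrite nth_cat szP lt'.
move=> /prefixP[v E]; apply: (@eq_from_nth _ 0); rewrite ?size_mkseq // => i lt.
rewrite nth_mkseq // -(nthP i m); first by rewrite E nth_cat lt.
by rewrite -szP E size_cat ltn_addr.
Qed.

Lemma kernel_gap_factorization (k n : nat) : 2 < k ->
  kernel_gap_product k n
  = mkseq (pd_limit k) (size (kernel_gap_product k n)).
Proof.
move=> k_gt2; apply: (@prefix_pd_limit k n).
suff [v] : exists v, iter n (pd k) [:: 0] = kernel_gap_product k n ++ v
    /\ 0 < size v by case=> -> _; rewrite prefix_prefix.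
elim: n => [|n [[|a v] [IH v0]] //]; first by exists [:: 0].
have pdv : exists m, pd k (a :: v) = [:: 0, m & pd k v].
  by rewrite /pd /morph /= /pd_letter; case: ifP => _; eexists.
case: pdv => m pdv; rewrite iterS IH pd_cat pd_kernel_gap_product // pdv.
case: ifP => _; first by exists [:: 0, m & pd k v]; rewrite cats0.
by exists (m :: pd k v); rewrite -catA.
Qed.

(* Main.v *)
Require Import Defs.
From mathcomp Require Import all_boot.
From mathcomp Require Import zify.

(** Up to a letter 0 lost or gained at the boundaries, s_k maps every ingredient
    of the formula at n to the same ingredient at n + 1: with b_n = 0 if k does
    not divide n, b_n empty otherwise, and W_n the prefix of R_(n+1) of length
    r_n + [k divides n], one has s_k(W_n) = b_(n+1) W_(n+1), and similar rules
    for the products of consecutive R_j G_j and for the gaps. The boundary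
    letters telescope, so the formula follows by induction from the case n = k,
    which is an identity between palindromic prefixes. The two truncated kernel
    words of the formula are W_(n-2) and the starred word W_n. *)

Definition boundary (k n : nat) : word :=
  if n == 0 %[mod k] then [::] else [:: 0].

Definition kernel_prefix (k n : nat) : word :=
  take (kernel_number k n + (n == 0 %[mod k])) (kernel_word k n.+1).

Definition kernel_gap_block (k m l : nat) : word :=
  flatten [seq kernel_word k j ++ gap k j | j <- iota m.+1 l].

Lemma eqmod_S1 (k n : nat) : (n.+1 == 1 %[mod k]) = (n == 0 %[mod k]).
Proof. by rewrite -addn1 (eqn_modDr 1 n 0). Qed.

Lemma boundaryDr (k n : nat) : boundary k (n + k) = boundary k n.
Proof. by rewrite /boundary modnDr. Qed.

Lemma pd_take (k c : nat) (u : word) : pd k (take c u) = take (2 * c) (pd k u).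
Proof.
have [le|/ltnW ge] := leqP c (size u); last first.
  by rewrite !take_oversize ?size_pd //; lia.
rewrite -{2}(cat_take_drop c u) pd_cat take_size_cat //.
by rewrite size_pd size_takel.
Qed.

(** Since r_(n+1) is 2 r_n + 1 if k divides n and 2 r_n - 1 otherwise, both cases of W_n have an
    image of length r_(n+1) + 1. The bound says that W_n fits inside R_(n+1). *)
Lemma kernel_number_double (k n : nat) : 2 < k ->
  2 * (kernel_number k n + (n == 0 %[mod k])) = (kernel_number k n.+1).+1 /\
  kernel_number k n + (n == 0 %[mod k]) <= kernel_number k n.+1.
Proof.
move=> k_gt2; have [pos E] := kernel_numberS n k_gt2.
have := eqmod_S1 k n; rewrite (@modn_small 1); last by lia.
by move=> <-; case: eqP E => /= _; lia.
Qed.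

Lemma pd_kernel_prefix (k n : nat) : 2 < k ->
  pd k (kernel_prefix k n) = boundary k n.+1 ++ kernel_prefix k n.+1.
Proof.
move=> k_gt2; have [dbl le] := kernel_number_double k n k_gt2.
have E := pd_kernel_word n k_gt2.
rewrite /kernel_prefix pd_take.
(* By the bound, the cut falls inside s_k(R_(n+1)), so the optional final 0 in [pd_kernel_word] is
   not reached. *)
set c := 2 * _; have -> : take c (pd k (kernel_word k n.+1))
  = take c (boundary k n.+1 ++ kernel_word k n.+2).
  by rewrite /boundary E takel_cat // size_pd size_kernel_word //; lia.
rewrite /c dbl /boundary; case: eqP => _ /=; first by rewrite addn1.
by rewrite addn0.
Qed.

(** The case n = 0 holds because [gap] is empty at 0 and 1; it lets the main induction start from
    G_0. *)
Lemma pd_gap_boundary (k n : nat) : 2 < k ->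
  (if n == 0 %[mod k] then [:: 0] else [::]) ++ gap k n.+1
  = pd k (gap k n) ++ boundary k n.+1.
Proof.
move=> k_gt2; case: n => [|n]; last by rewrite -eqmod_S1 pd_gap.
by rewrite /= eqxx /boundary mod0n modn_small ltnW // ltnW.
Qed.

Lemma kernel_gap_product_cat (k m l : nat) :
  kernel_gap_product k (m + l) =
    kernel_gap_product k m ++ kernel_gap_block k m l.
Proof. by rewrite /kernel_gap_product iotaD map_cat flatten_cat add1n. Qed.

(** Compare [pd_kernel_gap_product] at m and at m + l, and cancel the common prefix s_k(R_1 G_1 ...
    R_m G_m). *)
Lemma pd_kernel_gap_block (k m l : nat) : 2 < k ->
  boundary k m.+1 ++ kernel_gap_block k m.+1 l
  = pd k (kernel_gap_block k m l) ++ boundary k (m + l).+1.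
Proof.
move=> k_gt2; have := kernel_gap_product_cat k m.+1 l.
rewrite addSn !pd_kernel_gap_product // kernel_gap_product_cat pd_cat -!catA.
by move/eqP; rewrite eqseq_cat // eqxx /= => /eqP.
Qed.

Lemma catdown_kernel_gap (k m : nat) : 2 < k ->
  catdown (k - 1) 2 (fun i => kernel_word k (m + k - i) ++ gap k (m + k - i))
  = kernel_gap_block k m (k - 2).
Proof.
move=> k_gt2; rewrite /catdown /kernel_gap_block; congr flatten.
have -> : (k - 1).+1 - 2 = k - 2 by lia.
apply: (@eq_from_nth _ [::]) => [|i].
  by rewrite !size_map size_rev !size_iota.
rewrite size_map size_rev size_iota => lt.
rewrite !(nth_map 0) ?size_rev ?size_iota // nth_rev ?size_iota //.
rewrite !nth_iota //; last by lia.
by have -> : m + k - (2 + (k - 2 - i.+1)) = m.+1 + i by lia.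
Qed.

Lemma kernel_gap_product_small (k n : nat) : n < k ->
  kernel_gap_product k n = pal_prefix k n.
Proof.
elim: n => // n IH lt; rewrite kernel_gap_productS IH 1?ltnW //=.
by rewrite lt ltnW // modn_small 1?ltnW.
Qed.

Lemma iter_pd_letter (k m j : nat) : m + j < k ->
  iter m (pd k) [:: j] = pal_prefix k m ++ [:: m + j].
Proof.
elim: m => [|m IH] lt //; rewrite iterS IH; last by lia.
rewrite pd_cat -pd_pal_prefix; last by lia.
by rewrite -catA {2}/pd /morph /= /pd_letter (_ : m + j <= k - 2) //; lia.
Qed.

(** The formula at n = m + k, where t is s_k^(n-2)(2) with the starred word deleted. *)
Lemma gap_decomposition (k m : nat) : 2 < k ->
  exists t, iter (m + k - 2) (pd k) [:: 2] = t ++ kernel_prefix k (m + k) /\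
    gap k (m + k) = gap k m ++ kernel_gap_block k m (k - 2)
                      ++ kernel_prefix k (m + k - 2) ++ t.
Proof.
move=> k_gt2; elim: m => [|m [t [Et EG]]].
  (* For the original k, s_k^(k-2)(2) is the image of p_(k-3) (k-1), and s_k(k-1) = 00 = W_k. *)
  case: k k_gt2 => [|[|[|k]]] // _; exists (pd k.+3 (pal_prefix k.+3 k)).
  have -> : 0 + k.+3 - 2 = k.+1 by lia.
  rewrite add0n.
  split.
    rewrite iterS iter_pd_letter; last by lia.
    rewrite pd_cat /kernel_prefix kernel_number_small; last by lia.
    rewrite /= ltnn eqxx modnn mod0n eqxx /=.
    by rewrite {2}/pd /morph /= /pd_letter; case: ifP => //; lia.
  (* Apply s_k to p_(k-2) = p_(k-3) (k-3) p_(k-3): the middle letter gives 0 (k-2), whose 0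
     completes s_k(p_(k-3)) to p_(k-2) and whose k-2 is W_(k-2). *)
  have -> : gap k.+3 k.+3 = pd k.+3 (pal_prefix k.+3 k.+1).
    by rewrite /= ltnn modnn mod0n eqxx ltnSn.
  have -> : kernel_prefix k.+3 k.+1 = [:: k.+1].
    rewrite /kernel_prefix kernel_number_small; last by lia.
    by rewrite mod0n modn_small /= ?ltnS ?leqnSn.
  rewrite [pal_prefix _ k.+1]/= modn_small; last by lia.
  rewrite -[kernel_gap_block _ 0 _]/(kernel_gap_product _ _).
  rewrite kernel_gap_product_small // -pd_pal_prefix; last by lia.
  rewrite -cat1s !pd_cat -!catA; congr (_ ++ _).
  by rewrite {1}/pd /morph /= /pd_letter (_ : k <= _) //; lia.
have n2 : m.+1 + k - 2 = (m + k - 2).+1 by lia.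
have mk : m + (k - 2) = m + k - 2 by lia.
(* The letter that s_k(W_n) has in front of W_(n+1) moves into t. *)
exists (pd k t ++ boundary k m.+1); split.
  by rewrite n2 iterS Et pd_cat pd_kernel_prefix // -addSn boundaryDr -catA.
have := pd_gap_boundary k (m + k) k_gt2.
(* The letter before W_(n-1) passes leftwards through the block, then through G_(m+1), and finally
   cancels against the one before G_(n+1), as n and m agree mod k. *)
rewrite EG !pd_cat -addSn boundaryDr n2 pd_kernel_prefix //.
rewrite modnDr -!catA [pd k (kernel_gap_block _ _ _) ++ _]catA -mk.
rewrite -pd_kernel_gap_block // mk.
rewrite -!catA [pd k (gap k m) ++ _]catA -pd_gap_boundary // -!catA.
by move/eqP; rewrite eqseq_cat // eqxx /= => /eqP.
Qed.

Lemma factor_kernel_prefix (k n : nat) :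
  factor (kernel_word k n.+1) 1 (kernel_number k n + (n == 0 %[mod k]))
  = kernel_prefix k n.
Proof. by rewrite /factor drop0. Qed.

Lemma starred_kernel_prefix (k n : nat) : starred k n = kernel_prefix k n.
Proof.
rewrite -factor_kernel_prefix /starred.
by case: eqP => _; rewrite ?addn1 ?addn0.
Qed.

Theorem theorem6 (k n : nat) (hk : 3 <= k) (hn : k + 1 <= n) :
  suffix (starred k n) (iter (n - 2) (pd k) [:: 2]) /\
  gap k n =
    if n - 1 == 1 %[mod k] then
      gap k (n - k)
        ++ catdown (k - 1) 2 (fun i => kernel_word k (n - i) ++ gap k (n - i))
        ++ factor (kernel_word k (n - 1)) 1 (kernel_number k (n - 2) + 1)
        ++ rdel (iter (n - 2) (pd k) [:: 2]) (starred k n)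
    else
      gap k (n - k)
        ++ catdown (k - 1) 2 (fun i => kernel_word k (n - i) ++ gap k (n - i))
        ++ factor (kernel_word k (n - 1)) 1 (kernel_number k (n - 2))
        ++ rdel (iter (n - 2) (pd k) [:: 2]) (starred k n).
Proof.
have -> : n = (n - k) + k by lia.
set m := n - k; have [t [Et EG]] := gap_decomposition k m hk.
rewrite starred_kernel_prefix Et; split; first exact: suffix_suffix.
rewrite /rdel size_cat !addnK take_size_cat // catdown_kernel_gap //.
have -> : m + k - 1 = (m + k - 2).+1 by lia.
(* The test n - 1 = 1 mod k says that k divides n - 2, so both branches contain W_(n-2). *)
by rewrite eqmod_S1 EG -factor_kernel_prefix; case: eqP => _; rewrite ?addn0.
Qed.
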